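(* Every rational formal power series $f\in\mathbb{C}^{q\times q}\langle\langle z_1,\ldots,z_N\rangle\rangle_{\rm rat}$ which is matrix-inner in $\mathcal{D}_N$ belongs to the non-commutative Schur--Agler class $\mathcal{SA}_N^{\rm nc}(\mathbb{C}^q)=\mathcal{SA}_N^{\rm nc}(\mathbb{C}^q,\mathbb{C}^q)$.
   Context: $\mathcal{F}_N$ is the free monoid on generators $g_1,\ldots,g_N$ with empty word $\emptyset$; $|w|$ is the length of a word. A formal power series (FPS) in non-commuting indeterminates $z_1,\ldots,z_N$ is $f(z)=\sum_{w\in\mathcal{F}_N}f_wz^w$. A scalar FPS is rational if it is obtained from non-commutative polynomials by finitely many sums, products and inversions (of FPSs with non-zero constant term); a matrix FPS is rational if all its entries are. Evaluation. For $Z=(Z_1,\ldots,Z_N)\in(\mathbb{C}^{n\times n})^N$ and rational $f$, $f(Z)$ is obtained by substituting $Z_k$ for $z_k$ in a rational expression for $f$; near $Z=0$ it equals $\sum_wf_w\otimes Z^w$, and it is a $\mathbb{C}^{q\times q}\otimes\mathbb{C}^{n\times n}$-valued rational function of the entries of the $Z_k$, defined (holomorphic) on an open dense set containing a neighbourhood of $0$. Matrix-inner FPSs. Let $\mathbb{T}^{n\times n}$ be the set of unitary $n\times n$ matrices, $(\mathbb{D}^{n\times n})^N=\{W\in(\mathbb{C}^{n\times n})^N: W_kW_k^*<I_n,\ k=1,\ldots,N\}$, ${\rm clos}(\mathbb{D}^{n\times n})^N=\{W: W_kW_k^*\le I_n,\ k=1,\ldots,N\}$, and $\mathcal{D}_N=\coprod_{n\in\mathbb{N}}(\mathbb{D}^{n\times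 n})^N$. A rational FPS $f$ with coefficients in $\mathbb{C}^{q\times q}$ is matrix-inner in $\mathcal{D}_N$ if for every $n\in\mathbb{N}$: $f(W)f(W)^*=I_q\otimes I_n$ at all $W\in(\mathbb{T}^{n\times n})^N$ where $f(W)$ is defined, and $f(W)f(W)^*\le I_q\otimes I_n$ at all $W\in{\rm clos}(\mathbb{D}^{n\times n})^N$ where $f(W)$ is defined. The non-commutative Schur--Agler class $\mathcal{SA}_N^{\rm nc}(\mathcal{U},\mathcal{Y})$ ($\mathcal{U},\mathcal{Y}$ Hilbert spaces) consists of all FPSs $f$ with coefficients in $L(\mathcal{U},\mathcal{Y})$ such that for any separable Hilbert space $\mathcal{K}$ and any $N$-tuple $\delta=(\delta_1,\ldots,\delta_N)$ of strict contractions in $\mathcal{K}$ (i.e. $\|\delta_j\|<1$), the limit in the operator norm topology $f(\delta)=\lim_{m\to\infty}\sum_{|w|\le m}f_w\otimes\delta^w$ exists and defines a contractive operator in $L(\mathcal{U}\otimes\mathcal{K},\mathcal{Y}\otimes\mathcal{K})$. Here $\delta^w=\delta_{i_1}\cdots\delta_{i_k}$ for $w=g_{i_1}\cdots g_{i_k}$. *)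

(* Defs.v *)
From HB Require Import structures.
From mathcomp Require Import all_boot all_order all_algebra.
From mathcomp Require Import sesquilinear spectral.
From mathcomp Require Import complex mxtens.
From mathcomp Require Import all_classical all_reals all_analysis.

Set Implicit Arguments.
Unset Strict Implicit.
Unset Printing Implicit Defensive.

Import Order.TTheory GRing.Theory Num.Theory.
Import numFieldNormedType.Exports.

Local Open Scope classical_set_scope.
Local Open Scope ring_scope.
Local Open Scope sesquilinear_scope.

(* The free monoid on N generators is [seq 'I_N]: the empty word is [::] and
   the product is concatenation. *)
Definition word (N : nat) : Type := seq 'I_N.

Definition fps (N : nat) (V : Type) : Type := word N -> V.

Section ScalarFps.
Variables (C : fieldType) (N : nat).
Implicit Types f g : fps N C.

Definition fps_const (c : C) : fps N C := fun w => if w is [::] then c else 0.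

Definition fps_var (k : 'I_N) : fps N C := fun w => (w == [:: k])%:R.

Definition fps_add f g : fps N C := fun w => f w + g w.

Definition fps_mul f g : fps N C :=
  fun w => \sum_(i < (size w).+1) f (take i w) * g (drop i w).

Inductive rexpr : Type :=
| RConst of C
| RVar of 'I_N
| RAdd of rexpr & rexpr
| RMul of rexpr & rexpr
| RInv of rexpr.

(* [represents e f]: all inversions occurring in [e] are inversions of formal
   power series with non-zero constant term, and the resulting series is f. *)
Inductive represents : rexpr -> fps N C -> Prop :=
| represents_const c : represents (RConst c) (fps_const c)
| represents_var k : represents (RVar k) (fps_var k)
| represents_add e1 e2 f1 f2 :
    represents e1 f1 -> represents e2 f2 ->
    represents (RAdd e1 e2) (fps_add f1 f2)
| represents_mul e1 e2 f1 f2 :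
    represents e1 f1 -> represents e2 f2 ->
    represents (RMul e1 e2) (fps_mul f1 f2)
| represents_inv e f g :
    represents e f -> f [::] != 0 ->
    fps_mul f g = fps_const 1 -> fps_mul g f = fps_const 1 ->
    represents (RInv e) g.

(* The outcome [None] means that some inverse occurring in the expression does
   not exist at W. *)
Fixpoint reval (n : nat) (W : 'I_N -> 'M[C]_n) (e : rexpr) : option 'M[C]_n :=
  match e with
  | RConst c => Some c%:M
  | RVar k => Some (W k)
  | RAdd e1 e2 =>
      if (reval W e1, reval W e2) is (Some A, Some B) then Some (A + B)
      else None
  | RMul e1 e2 =>
      if (reval W e1, reval W e2) is (Some A, Some B) then Some (A *m B)
      else None
  | RInv e1 =>
      if reval W e1 is Some A
      then (if A \in unitmx then Some (invmx A) else None) else None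
  end.

End ScalarFps.

Section MatrixFps.
Variables (C : numClosedFieldType) (N : nat).

Definition rational_fps (p q : nat) (f : fps N 'M[C]_(p, q)) : Prop :=
  forall i j, exists e : rexpr C N, represents e (fun w => f w i j).

(* [fps_value f W A]: f is defined at W, with f(W) = A; the value is computed
   by substituting W into rational expressions for the entries of f. *)
Definition fps_value (p q n : nat) (f : fps N 'M[C]_(p, q))
    (W : 'I_N -> 'M[C]_n) (A : 'M[C]_(p * n, q * n)) : Prop :=
  exists (e : 'I_p -> 'I_q -> rexpr C N) (F : 'I_p -> 'I_q -> 'M[C]_n),
    [/\ forall i j, represents (e i j) (fun w => f w i j),
        forall i j, reval W (e i j) = Some (F i j) &
        A = \sum_i \sum_j (delta_mx i j *t F i j)].

(* On [C], 0 <= z means that z is real and nonnegative; hence positive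
   semidefinite matrices in this sense are Hermitian. *)
Definition lowner_le (n : nat) (A B : 'M[C]_n) : Prop :=
  forall x : 'rV[C]_n, 0 <= (x *m (B - A) *m x ^t*) 0 0.

Definition matrix_inner (q : nat) (f : fps N 'M[C]_q) : Prop :=
  forall n : nat, (0 < n)%N ->
    (forall (W : 'I_N -> 'M[C]_n) (A : 'M[C]_(q * n)),
        (forall k, W k \is unitarymx) -> fps_value f W A ->
        A *m A ^t* = 1%:M *t 1%:M)
    /\
    (forall (W : 'I_N -> 'M[C]_n) (A : 'M[C]_(q * n)),
        (forall k, lowner_le (W k *m (W k) ^t*) 1%:M) -> fps_value f W A ->
        lowner_le (A *m A ^t*) (1%:M *t 1%:M)).

End MatrixFps.

Section SchurAgler.
Variable R : realType.
Local Notation C := R[i].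

(* A Hilbert space is a complete normed space over C whose norm comes from an
   inner product. *)
Definition hilbert_dot (K : completeNormedModType C)
    (ip : {dot K for Num.conj}) : Prop :=
  forall x : K, `|x| ^+ 2 = ip x x.

Definition separable (T : topologicalType) : Prop :=
  exists2 D : set T, countable D & dense D.

(* In MathComp-Analysis the norm of a normed space over C takes (nonnegative
   real) values in C. *)
Definition rnorm (K : normedModType C) (x : K) : R := complex.Re `|x|.

(* [{ffun 'I_q -> K}] with this norm is the Hilbert space tensor product of
   C^q and K, the tensor e_i (x) h being the family with h at i and 0
   elsewhere. *)
Definition rnorm2 (K : normedModType C) (q : nat) (x : {ffun 'I_q -> K}) : R :=
  Num.sqrt (\sum_i rnorm (x i) ^+ 2).

Definition opnorm (U V : Type) (nU : U -> R) (nV : V -> R) (T : U -> V) :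
    \bar R :=
  ereal_sup [set (nV (T x))%:E | x in [set x | nU x <= 1]].

Definition word_prod (N : nat) (K : Type) (delta : 'I_N -> K -> K)
    (w : word N) : K -> K :=
  foldr (fun k T => delta k \o T) id w.

(* The operator \sum_(|w| <= m) f_w (x) delta^w from C^q (x) K to C^p (x) K. *)
Definition partial_sum (N p q : nat) (f : fps N 'M[C]_(p, q)) (K : lmodType C)
    (delta : 'I_N -> K -> K) (m : nat) (x : {ffun 'I_q -> K}) :
    {ffun 'I_p -> K} :=
  [ffun i => \sum_(k < m.+1) \sum_(w : k.-tuple 'I_N) \sum_(j < q)
     f (tval w) i j *: word_prod delta (tval w) (x j)].

(* The non-commutative Schur-Agler class, for the coefficient spaces C^q
   (input) and C^p (output). *)
Definition schur_agler_nc (N p q : nat) (f : fps N 'M[C]_(p, q)) : Prop :=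
  forall (K : completeNormedModType C) (ip : {dot K for Num.conj}),
    hilbert_dot ip -> separable K ->
  forall delta : 'I_N -> {linear K -> K},
    (forall k, (opnorm (@rnorm K) (@rnorm K) (delta k) < 1)%E) ->
  exists T : {linear {ffun 'I_q -> K} -> {ffun 'I_p -> K}},
    opnorm (@rnorm2 K q) (@rnorm2 K p)
        (fun x => T x - partial_sum f (fun k => delta k) m x)
      @[m --> \oo] --> 0%E
    /\ (opnorm (@rnorm2 K q) (@rnorm2 K p) T <= 1)%E.

End SchurAgler.

(* Main.v *)
(* An expression representing a series f can be evaluated at every jointly
   nilpotent tuple W, with value the finite sum of the f_w (x) W^w, because an
   identity f g = 1 of series becomes f(W) g(W) = 1. Let delta be a tuple of
   contractions on a Hilbert space K. Then the tuple S (x) delta_k on K^(M+1), S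
   being the nilpotent shift, consists of contractions and vanishes on words of
   length M + 1; restricted to the finite-dimensional invariant subspace generated
   by given vectors, it is a tuple of contractive matrices at which f is defined.
   Since f is matrix-inner, the lower triangular block Toeplitz operator
   f(S (x) delta), whose blocks are the homogeneous parts f_k(delta), is therefore
   contractive. Applied to (x, 0, .., 0) it gives |f_k(delta) x| <= |x|, hence by
   homogeneity geometric convergence of the series at strict contractions.
   Applied to (x, x, .., x) it gives \sum_(l <= M) |S_l x|^2 <= (M + 1) |x|^2 for
   the partial sums S_l, and averaging shows that their limit is contractive. *)
From HB Require Import structures.
Require Import Defs.
From mathcomp Require Import all_boot all_order all_algebra.
From mathcomp Require Import sesquilinear spectral.
From mathcomp Require Import complex mxtens.
From mathcomp Require Import all_classical all_reals all_analysis.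
From mathcomp Require Import ring lra.

Set Implicit Arguments.
Unset Strict Implicit.
Unset Printing Implicit Defensive.

Import Order.TTheory GRing.Theory Num.Theory.
Import numFieldNormedType.Exports.

Local Open Scope classical_set_scope.
Local Open Scope complex_scope.
Local Open Scope ring_scope.
Local Open Scope sesquilinear_scope.

(** * Sums over words and over antidiagonals *)

Lemma big_tuple0 (T : finType) (V : nmodType) (F : seq T -> V) :
  \sum_(w : 0.-tuple T) F w = F [::].
Proof.
rewrite (bigD1 [tuple]) //= big1 ?addr0 // => w.
by rewrite [w]tuple0 => /eqP.
Qed.

Lemma big_tupleS (T : finType) (V : nmodType) k (F : seq T -> V) :
  \sum_(w : k.+1.-tuple T) F w = \sum_a \sum_(w : k.-tuple T) F (a :: w).
Proof.
rewrite pair_bigA /= (reindex (fun p : T * k.-tuple T => [tuple of p.1 :: p.2])) //=.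
exists (fun w : k.+1.-tuple T => (thead w, [tuple of behead w])) => [[a w] _|w _] /=.
  by congr pair; apply/val_inj.
by rewrite [RHS]tuple_eta; apply/val_inj.
Qed.

(** Substituting [k = i + j] turns the left side into a sum over the triangle [i + j < M]; the rest
    of the square contributes nothing by hypothesis. This is the Cauchy product of two truncated
    series. *)
Lemma sum_antidiagonal (V : nmodType) (M : nat) (F : nat -> nat -> V) :
    (forall i j, (i < M)%N -> (j < M)%N -> (M <= i + j)%N -> F i j = 0) ->
  \sum_(k < M) \sum_(i < k.+1) F i (k - i)%N = \sum_(i < M) \sum_(j < M) F i j.
Proof.
move=> F0.
under eq_bigr => k _ do rewrite (big_ord_widen_cond M predT (fun i => F i (k - i)%N)) //=.
rewrite (exchange_big_dep predT) //=; apply: eq_bigr => i _.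
rewrite [RHS](bigID (fun j : 'I_M => i + j < M)%N) /= [X in _ + X]big1 ?addr0; last first.
  by move=> j; rewrite -leqNgt => /F0; apply.
rewrite -(big_mkord (fun k => i < k.+1)%N (fun k => F i (k - i)%N)).
rewrite -(big_mkord (fun j => i + j < M)%N (fun j => F i j)).
rewrite (big_cat_nat (n := i)) ?(ltnW (ltn_ord i)) //= big_nat_cond big1 ?add0r; last first.
  by move=> k /andP[/andP[_ ki]]; rewrite ltnS leqNgt ki.
rewrite -{1}[i : nat]add0n big_addn [RHS](big_cat_nat (n := M - i)) ?(leq_subr i M) //=.
rewrite [X in _ + X]big_nat_cond [X in _ + X]big1 ?addr0; last first.
  by move=> k /andP[/andP[]]; rewrite leq_subLR leqNgt => /negbTE ->.
rewrite big_nat_cond [RHS]big_nat_cond; apply: eq_big => [k|k _]; last by rewrite addnK.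
by rewrite ltnS leq_addl andbT /= ltn_subRL; case: (i + k < M)%N.
Qed.

(** * Homogeneous parts of scalar series and evaluation at jointly nilpotent tuples *)

Section HomogeneousParts.
Variables (C : fieldType) (N n : nat) (W : 'I_N -> 'M[C]_n).
Implicit Types f g : fps N C.

Definition word_mx (w : word N) : 'M[C]_n := foldr (fun k A => W k *m A) 1%:M w.

Lemma word_mx_cat u v : word_mx (u ++ v) = word_mx u *m word_mx v.
Proof. by elim: u => [|k u IH] /=; rewrite ?mul1mx // IH mulmxA. Qed.

Definition hom_eval (k : nat) f : 'M[C]_n :=
  \sum_(w : k.-tuple 'I_N) f w *: word_mx w.

Lemma hom_eval0 f : hom_eval 0 f = (f [::])%:M.
Proof.
by rewrite /hom_eval (big_tuple0 (fun w => f w *: word_mx w)) /= scalemx1.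
Qed.

Lemma hom_evalS k f :
  hom_eval k.+1 f = \sum_a W a *m hom_eval k (fun w => f (a :: w)).
Proof.
rewrite /hom_eval (big_tupleS _ (fun w => f w *: word_mx w)).
apply: eq_bigr => a _; rewrite mulmx_sumr; apply: eq_bigr => w _.
by rewrite /= scalemxAr.
Qed.

Lemma eq_hom_eval k f g : f =1 g -> hom_eval k f = hom_eval k g.
Proof. by move=> fg; apply: eq_bigr => w _; rewrite fg. Qed.

Lemma hom_evalD k f g : hom_eval k (fps_add f g) = hom_eval k f + hom_eval k g.
Proof. by rewrite -big_split; apply: eq_bigr => w _; rewrite scalerDl. Qed.

Lemma hom_evalZ k c f : hom_eval k (fun w => c * f w) = c *: hom_eval k f.
Proof. by rewrite scaler_sumr; apply: eq_bigr => w _; rewrite scalerA. Qed.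

Lemma fps_mul_cons f g a w :
  fps_mul f g (a :: w) =
    f [::] * g (a :: w) + fps_mul (fun u => f (a :: u)) g w.
Proof. by rewrite /fps_mul /= big_ord_recl. Qed.

(** Induction on the degree, for all [f] at once: removing the first letter of a word splits the
    convolution into the term with [f [::]] and a convolution of the left-shifted series with
    [g]. *)
Lemma hom_evalM k f g :
  hom_eval k (fps_mul f g) = \sum_(i < k.+1) hom_eval i f *m hom_eval (k - i) g.
Proof.
elim: k f => [|k IH] f.
  by rewrite big_ord1 !hom_eval0 /fps_mul big_ord1 /= scalar_mxM.
rewrite big_ord_recl subn0 hom_eval0 mul_scalar_mx !hom_evalS.
under [X in _ + X]eq_bigr => i _ do rewrite hom_evalS subSS mulmx_suml.
rewrite exchange_big scaler_sumr -big_split; apply: eq_bigr => a _ /=.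
under [X in _ = _ + X]eq_bigr => i _ do rewrite -mulmxA.
rewrite -mulmx_sumr -IH scalemxAr -hom_evalZ -mulmxDr -hom_evalD.
congr (_ *m _); apply: eq_hom_eval => w; exact: fps_mul_cons.
Qed.

Lemma hom_eval_const k c : hom_eval k.+1 (fps_const c) = 0.
Proof.
rewrite hom_evalS big1 // => a _; rewrite /hom_eval big1 ?mulmx0 // => w _.
by rewrite /= scale0r.
Qed.

Lemma hom_eval_var k a : hom_eval k (fps_var C a) = (k == 1)%:R *: W a.
Proof.
case: k => [|k]; first by rewrite hom_eval0 scale0r /fps_var raddf0.
rewrite hom_evalS (bigD1 a) //= big1 ?addr0; last first.
  move=> b ba; rewrite /hom_eval big1 ?mulmx0 // => w _.
  by rewrite /fps_var eqseq_cons (negbTE ba) scale0r.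
(* Stripping the leading letter from the series of the variable [a] leaves the constant series 1. *)
rewrite (@eq_hom_eval _ _ (fps_const 1)); last first.
  by move=> [|b w]; rewrite /fps_var /fps_const eqseq_cons eqxx.
case: k => [|k]; first by rewrite hom_eval0 mulmx1 scale1r.
by rewrite hom_eval_const mulmx0 scale0r.
Qed.

Variable M : nat.
Hypothesis W_nilp : forall w, size w = M.+1 -> word_mx w = 0.

Lemma word_mx_nilp w : (M < size w)%N -> word_mx w = 0.
Proof.
move=> Mw; rewrite -(cat_take_drop M.+1 w) word_mx_cat W_nilp ?mul0mx //.
by rewrite size_takel.
Qed.

Lemma hom_eval_nilp i j f g :
  (M < i + j)%N -> hom_eval i f *m hom_eval j g = 0.
Proof.
move=> Mij; rewrite mulmx_suml big1 // => u _; rewrite mulmx_sumr big1 // => v _.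
rewrite -scalemxAl -scalemxAr -word_mx_cat word_mx_nilp ?scaler0 //.
by rewrite size_cat !size_tuple.
Qed.

(** Under [W_nilp] every word longer than [M] vanishes at [W], so this truncation is the whole
    series at [W]. *)
Definition nilp_eval f : 'M[C]_n := \sum_(k < M.+1) hom_eval k f.

Lemma nilp_eval_const c : nilp_eval (fps_const c) = c%:M.
Proof.
rewrite /nilp_eval big_ord_recl hom_eval0 big1 ?addr0 // => k _.
by rewrite hom_eval_const.
Qed.

Lemma nilp_evalM f g : nilp_eval (fps_mul f g) = nilp_eval f *m nilp_eval g.
Proof.
rewrite /nilp_eval mulmx_suml; under [RHS]eq_bigr do rewrite mulmx_sumr.
under [LHS]eq_bigr do rewrite hom_evalM.
rewrite (sum_antidiagonal (F := fun i j => hom_eval i f *m hom_eval j g)) //.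
by move=> i j _ _; exact: hom_eval_nilp.
Qed.

(* If [f * g = 1] as series then the two nilpotent evaluations are mutually
   inverse, so the inverses occurring in an expression always exist. *)
Lemma reval_nilp e f : represents e f -> reval W e = Some (nilp_eval f).
Proof.
elim=> {e f} [c|k|e1 e2 f1 f2 _ IH1 _ IH2|e1 e2 f1 f2 _ IH1 _ IH2|e f g _ IH _ fg gf] /=.
- by rewrite nilp_eval_const.
(* For [M = 0] the truncation stops before degree one, but then [W_nilp] on one-letter words forces
   [W k = 0]. *)
- congr Some; case: (posnP M) => [M0|M_gt0].
    rewrite /nilp_eval M0 big_ord1 hom_eval_var scale0r.
    by have := @W_nilp [:: k]; rewrite M0 /= mulmx1; apply.
  rewrite /nilp_eval (bigD1 (Ordinal (M_gt0 : 1 < M.+1)%N)) //= hom_eval_var scale1r.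
  by rewrite big1 ?addr0 // => i /eqP/val_eqP /= i1; rewrite hom_eval_var (negbTE i1) scale0r.
- rewrite IH1 IH2 /nilp_eval -big_split; congr Some.
  by apply: eq_bigr => k _; rewrite hom_evalD.
- by rewrite IH1 IH2 nilp_evalM.
rewrite IH; have FG : nilp_eval f *m nilp_eval g = 1%:M.
  by rewrite -nilp_evalM fg nilp_eval_const.
case: (mulmx1_unit FG) => -> _; congr Some.
by rewrite -[LHS]mulmx1 -FG mulKmx //; case: (mulmx1_unit FG).
Qed.

End HomogeneousParts.

(** * Contractive matrices and block columns *)

Section MatrixContractions.
Variables (C : numClosedFieldType).

Definition sqnorm_col n (c : 'cV[C]_n) : C := \sum_i `|c i 0| ^+ 2.

Lemma sqnorm_colE n (c : 'cV[C]_n) : (c ^t* *m c) 0 0 = sqnorm_col c.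
Proof. by rewrite mxE; apply: eq_bigr => i _; rewrite !mxE mulrC -normCK. Qed.

Lemma sqnorm_col_ge0 n (c : 'cV[C]_n) : 0 <= sqnorm_col c.
Proof. by apply: sumr_ge0 => i _; rewrite exprn_ge0. Qed.

Lemma trmxC_mul m n p (A : 'M[C]_(m, n)) (B : 'M[C]_(n, p)) :
  (A *m B) ^t* = B ^t* *m A ^t*.
Proof. by rewrite trmx_mul map_mxM. Qed.

(** The quadratic form of [1 - A A^*] at a row [x] is the difference of the squared norms of [x^*]
    and [A^* x^*]; hence the adjoint on the right. *)
Lemma lowner_le1P n (A : 'M[C]_n) :
  lowner_le (A *m A ^t*) 1%:M <->
  forall c, sqnorm_col (A ^t* *m c) <= sqnorm_col c.
Proof.
have E (x : 'rV[C]_n) : (x *m (1%:M - A *m A ^t*) *m x ^t*) 0 0 =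
    sqnorm_col (x ^t*) - sqnorm_col (A ^t* *m x ^t*).
  rewrite -!sqnorm_colE mulmxBr mulmx1 mulmxBl !trmxC_mul !trmxCK !mulmxA.
  by rewrite [LHS]mxE [X in _ + X]mxE.
split=> H x; last by rewrite E subr_ge0.
by have := H (x ^t*); rewrite E trmxCK subr_ge0.
Qed.

(* Expand [0 <= |A^* A c - c|^2]. *)
Lemma contraction_adjoint n (A : 'M[C]_n) :
    (forall c, sqnorm_col (A ^t* *m c) <= sqnorm_col c) ->
  forall c, sqnorm_col (A *m c) <= sqnorm_col c.
Proof.
move=> hA c; have := sqnorm_col_ge0 (A ^t* *m (A *m c) - c).
have -> : sqnorm_col (A ^t* *m (A *m c) - c) =
    sqnorm_col (A ^t* *m (A *m c)) - sqnorm_col (A *m c) - sqnorm_col (A *m c)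
    + sqnorm_col c.
  rewrite -!sqnorm_colE.
  have -> : (A ^t* *m (A *m c) - c) ^t* = (A ^t* *m (A *m c)) ^t* - c ^t*.
    by rewrite linearB /= map_mxB.
  rewrite mulmxBl !mulmxBr !trmxC_mul !trmxCK !mulmxA !mxE.
  by rewrite opprB addrA addrAC.
have := hA (A *m c); set a := sqnorm_col (A *m c); set b := sqnorm_col c.
set d := sqnorm_col (A ^t* *m _) => da h.
rewrite -subr_ge0; apply: (le_trans h); rewrite [_ + b]addrC lerD2l.
by rewrite gerDr subr_le0.
Qed.

(** The vector sum of [e_i (x) x_i], with indices ordered as in [*t]. *)
Definition tens_col q n (x : 'I_q -> 'cV[C]_n) : 'cV[C]_(q * n) :=
  \col_k x (mxtens_unindex k).1 (mxtens_unindex k).2 0.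

Lemma big_mxtens (V : nmodType) q n (F : 'I_q -> 'I_n -> V) :
  \sum_(k < q * n) F (mxtens_unindex k).1 (mxtens_unindex k).2 =
  \sum_i \sum_j F i j.
Proof.
rewrite pair_bigA (reindex (@mxtens_index q n)); last first.
  by exists (@mxtens_unindex q n) => k _; rewrite ?mxtens_indexK ?mxtens_unindexK.
by apply: eq_bigr => ij _; rewrite mxtens_indexK.
Qed.

Lemma sqnorm_tens_col q n (x : 'I_q -> 'cV[C]_n) :
  sqnorm_col (tens_col x) = \sum_i sqnorm_col (x i).
Proof.
rewrite -(big_mxtens (fun i j => `|x i j 0| ^+ 2)).
by apply: eq_bigr => k _; rewrite mxE.
Qed.

(** The matrix on the left, in the form prescribed by [fps_value], is the block matrix with blocks
    [F i j]. *)
Lemma mul_tens_col p q n (F : 'I_p -> 'I_q -> 'M[C]_n) (x : 'I_q -> 'cV[C]_n) :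
  (\sum_i \sum_j (delta_mx i j *t F i j)) *m tens_col x =
  tens_col (fun i => \sum_j F i j *m x j).
Proof.
apply/colP => k; rewrite !mxE summxE.
transitivity (\sum_(l < q * n) F (mxtens_unindex k).1 (mxtens_unindex l).1
   (mxtens_unindex k).2 (mxtens_unindex l).2
   * x (mxtens_unindex l).1 (mxtens_unindex l).2 0).
  apply: eq_bigr => l _; rewrite [tens_col x _ _]mxE; congr (_ * _).
  rewrite summxE (bigD1 (mxtens_unindex k).1) //= [X in _ + X]big1 ?addr0; last first.
    move=> i ik; rewrite summxE big1 // => j _.
    by rewrite !mxE eq_sym (negbTE ik) mul0r.
  rewrite summxE (bigD1 (mxtens_unindex l).1) //= big1 ?addr0; last first.
    by move=> j jl; rewrite !mxE [_ == j]eq_sym (negbTE jl) andbF mul0r.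
  by rewrite !mxE !eqxx mul1r.
rewrite (big_mxtens (fun i j => F (mxtens_unindex k).1 i (mxtens_unindex k).2 j * x i j 0)).
by apply: eq_bigr => j _; rewrite mxE.
Qed.

Lemma tens_mx11 q n : 1%:M *t 1%:M = 1%:M :> 'M[C]_(q * n).
Proof.
apply/matrixP => k l; rewrite !mxE -natrM mulnb.
by rewrite -(inj_eq (can_inj (@mxtens_unindexK q n))) -pair_eqE.
Qed.

End MatrixContractions.

(** * Orthonormal families and restriction to finite-dimensional invariant subspaces *)

Section InnerProduct.
Variables (C : numClosedFieldType) (H : lmodType C) (ip : {dot H for Num.conj}).

Lemma dotC u v : ip u v = (ip v u)^*.
Proof. by rewrite hermC expr0 mul1r. Qed.

Lemma dotZl a u v : ip (a *: u) v = a * ip u v.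
Proof. by rewrite linearZl_LR. Qed.

Lemma dotZr a u v : ip u (a *: v) = a^* * ip u v.
Proof. by rewrite linearZr_LR. Qed.

Lemma dotDl u v w : ip (u + v) w = ip u w + ip v w.
Proof. exact: linearDl. Qed.

Lemma dotDr u v w : ip u (v + w) = ip u v + ip u w.
Proof. exact: linearDr. Qed.

Lemma dotBl u v w : ip (u - v) w = ip u w - ip v w.
Proof. exact: linearBl. Qed.

Lemma dot_suml I (r : seq I) (F : I -> H) v :
  ip (\sum_(i <- r) F i) v = \sum_(i <- r) ip (F i) v.
Proof. exact: linear_sumlz. Qed.

Lemma dot_sumr I (r : seq I) (F : I -> H) v :
  ip v (\sum_(i <- r) F i) = \sum_(i <- r) ip v (F i).
Proof. exact: linear_sumr. Qed.

Lemma dot_ge0 u : 0 <= ip u u.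
Proof.
have [->|u0] := eqVneq u 0; first by rewrite linear0l.
exact/ltW/neq0_dnorm_gt0.
Qed.

(** The third clause says that each [e i] lies in the span of [s], phrased as an induction principle
    so that linear identities checked on [s] transfer to [e]. *)
Lemma gram_schmidt (s : seq H) : exists (n : nat) (e : 'I_n -> H),
  [/\ forall i j, ip (e i) (e j) = (i == j)%:R,
      forall v, v \in s -> v = \sum_i ip v (e i) *: e i &
      forall P : H -> Prop, P 0 ->
        (forall a u v, P u -> P v -> P (a *: u + v)) ->
        (forall v, v \in s -> P v) -> forall i, P (e i)].
Proof.
elim: s => [|v s [n [e [e_on e_dec e_span]]]].
  by exists 0%N, (fun=> 0); split=> [[]|//|P _ _ _ []].
pose p := \sum_i ip v (e i) *: e i.
(* If [v] is already in the span of [e], the family is kept; otherwise the normalised residual [u]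
   of [v] is added in front. *)
have [vp|u0] := eqVneq (v - p) 0.
  exists n, e; split=> [//|w|P P0 Plin Ps i].
    by rewrite inE => /predU1P[->|/e_dec//]; exact: subr0_eq.
  by apply: (e_span P) => // w ws; apply: Ps; rewrite inE ws orbT.
have p_e j : ip p (e j) = ip v (e j).
  rewrite dot_suml (bigD1 j) //= dotZl e_on eqxx mulr1 big1 ?addr0 // => i ij.
  by rewrite dotZl e_on (negbTE ij) mulr0.
have ort j : ip (v - p) (e j) = 0 by rewrite dotBl p_e subrr.
pose c := sqrtC (ip (v - p) (v - p)).
have c_gt0 : 0 < c by rewrite sqrtC_gt0 neq0_dnorm_gt0.
pose u := c^-1 *: (v - p).
have uE : v - p = c *: u by rewrite scalerA divff ?gt_eqF // scale1r.
have u_e j : ip u (e j) = 0 by rewrite dotZl ort mulr0.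
have e_u j : ip (e j) u = 0 by rewrite dotC u_e rmorph0.
have u_u : ip u u = 1.
  have : ip (v - p) (v - p) = c ^+ 2 by rewrite sqrtCK.
  rewrite uE dotZl dotZr /= (CrealP (gtr0_real c_gt0)) mulrA -expr2.
  move=> /(canRL (mulKf _)) ->; rewrite ?expf_neq0 ?gt_eqF //.
  by rewrite mulVf // expf_neq0 // gt_eqF.
have p_u : ip p u = 0.
  by rewrite dot_suml big1 // => i _; rewrite dotZl e_u mulr0.
exists n.+1, (fun i => if unlift ord0 i is Some j then e j else u); split.
- move=> i j /=.
  by case: (unliftP ord0 i) => [i' ->|->]; case: (unliftP ord0 j) => [j' ->|->] //=.
- move=> w ws; rewrite big_ord_recl unlift_none.
  under eq_bigr do rewrite liftK.
  move: ws; rewrite inE => /predU1P[->|/e_dec wE].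
    rewrite -/p -[in ip v u](subrK p v) dotDl p_u addr0 uE dotZl u_u mulr1.
    by rewrite -uE subrK.
  have -> : ip w u = 0.
    by rewrite wE dot_suml big1 // => i _; rewrite dotZl e_u mulr0.
  by rewrite scale0r add0r.
move=> P P0 Plin Ps i; have Pe j : P (e j).
  by apply: (e_span P) => // w ws; apply: Ps; rewrite inE ws orbT.
case: unliftP => [j _|_]; first exact: Pe.
have Pp : P p.
  apply: (big_ind P) => // [a b Pa Pb|j _].
    by rewrite -[a]scale1r; exact: Plin.
  by rewrite -[_ *: _]addr0; exact: Plin.
have Pvp : P (v - p).
  by rewrite addrC -scaleN1r; apply: (Plin) => //; apply: Ps; rewrite inE eqxx.
by rewrite /u -[_ *: _]addr0; exact: Plin.
Qed.

Section OrthonormalFamily.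
Variables (n : nat) (e : 'I_n -> H).
Hypothesis e_on : forall i j, ip (e i) (e j) = (i == j)%:R.

Definition combination (c : 'cV[C]_n) : H := \sum_i c i 0 *: e i.

Lemma combination_is_linear : linear combination.
Proof.
move=> a c d; rewrite /combination scaler_sumr -big_split; apply: eq_bigr => i _.
by rewrite !mxE scalerDl scalerA.
Qed.

HB.instance Definition _ :=
  GRing.isLinear.Build C 'cV[C]_n H _ combination combination_is_linear.

Lemma dot_combination c : ip (combination c) (combination c) = sqnorm_col c.
Proof.
rewrite dot_suml; apply: eq_bigr => i _; rewrite dotZl dot_sumr.
rewrite (bigD1 i) //= dotZr e_on eqxx mulr1 big1 ?addr0 ?normCK // => j ji.
by rewrite dotZr e_on eq_sym (negbTE ji) mulr0.
Qed.

Lemma combination_inj : injective combination.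
Proof.
move=> c d /eqP; rewrite -subr_eq0 -linearB => /eqP cd0.
have := dot_combination (c - d); rewrite cd0 linear0l => /esym/psumr_eq0P cd.
apply/colP => i; apply/eqP; rewrite -subr_eq0.
have := cd (fun i _ => exprn_ge0 2 (normr_ge0 _)) i isT.
by move/eqP; rewrite sqrf_eq0 normr_eq0 !mxE.
Qed.

Variables (N : nat) (delta : 'I_N -> {linear H -> H}).
Hypothesis delta_e :
  forall k j, delta k (e j) = \sum_i ip (delta k (e j)) (e i) *: e i.

(** The hypothesis [delta_e] makes the span of [e] invariant; this is then the matrix of the
    restriction of [delta k] in the basis [e]. *)
Definition coord_mx (k : 'I_N) : 'M[C]_n := \matrix_(i, j) ip (delta k (e j)) (e i).

Lemma combination_coord_mx k c :
  delta k (combination c) = combination (coord_mx k *m c).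
Proof.
rewrite linear_sum; under eq_bigr do rewrite linearZ /= delta_e scaler_sumr.
rewrite exchange_big; apply: eq_bigr => i _.
rewrite mxE scaler_suml; apply: eq_bigr => j _.
by rewrite scalerA mxE mulrC.
Qed.

Lemma combination_word_mx w c :
  word_prod (fun k => delta k) w (combination c) =
  combination (word_mx coord_mx w *m c).
Proof.
elim: w => [|k w IH] /=; first by rewrite mul1mx.
by rewrite IH combination_coord_mx mulmxA.
Qed.

Lemma word_mx_coord_eq0 w :
  (forall x, word_prod (fun k => delta k) w x = 0) -> word_mx coord_mx w = 0.
Proof.
move=> w0; apply/matrixP => i j; rewrite [RHS]mxE.
have : word_mx coord_mx w *m delta_mx j 0 = 0 :> 'cV_n.
  by apply: combination_inj; rewrite -combination_word_mx w0 linear0.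
by rewrite -colE => /colP/(_ i); rewrite !mxE.
Qed.

(** The matrix is contractive as the restriction of a contraction. The Loewner inequality concerns
    its adjoint, hence the passage through [contraction_adjoint]. *)
Lemma lowner_coord_mx k : (forall x, ip (delta k x) (delta k x) <= ip x x) ->
  lowner_le (coord_mx k *m (coord_mx k) ^t*) 1%:M.
Proof.
move=> hk; apply/lowner_le1P.
apply: (@contraction_adjoint _ _ ((coord_mx k) ^t*)) => c.
by rewrite trmxCK -!dot_combination -combination_coord_mx.
Qed.

End OrthonormalFamily.
End InnerProduct.

(** * The inner property at nilpotent contractions *)

Section NilpotentContractions.
Variables (R : realType) (N q : nat) (f : fps N 'M[R[i]]_q).
Hypotheses (f_rat : rational_fps f) (f_inner : matrix_inner f).

Lemma matrix_inner_nilpotent n (W : 'I_N -> 'M[R[i]]_n) M (x : 'I_q -> 'cV[R[i]]_n) :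
    (forall k, lowner_le (W k *m (W k) ^t*) 1%:M) ->
    (forall w, size w = M.+1 -> word_mx W w = 0) ->
  \sum_i sqnorm_col (\sum_j nilp_eval W M (fun w => f w i j) *m x j) <=
  \sum_j sqnorm_col (x j).
Proof.
(* Size 0 is treated apart, since [matrix_inner] speaks of positive sizes only. *)
case: n W x => [|n] W x W_contr W_nilp.
  by rewrite !big1 // => i _; rewrite /sqnorm_col big_ord0.
have /choice[e he] : forall i, exists e : 'I_q -> rexpr R[i] N,
    forall j, represents (e j) (fun w => f w i j).
  by move=> i; have [e he] := choice (f_rat i); exists e.
pose F i j := nilp_eval W M (fun w => f w i j).
have [_ /(_ W _ W_contr)] := f_inner (ltn0Sn n).
move=> /(_ (\sum_i \sum_j (delta_mx i j *t F i j))) fW.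
set A := \sum_i _ in fW.
have {}fW : fps_value f W A -> lowner_le (A *m A ^t*) 1%:M by rewrite -tens_mx11.
have /fW/lowner_le1P/contraction_adjoint : fps_value f W A.
  by exists e, F; split=> // i j; exact: (reval_nilp W_nilp).
by move=> /(_ (tens_col x)); rewrite mul_tens_col !sqnorm_tens_col.
Qed.

(** Passage from matrices to operators on a possibly infinite-dimensional space: only a
    finite-dimensional invariant subspace containing the [x j] matters. *)
Lemma nilpotent_contraction (H : lmodType R[i]) (ip : {dot H for Num.conj})
    (delta : 'I_N -> {linear H -> H}) M (x : {ffun 'I_q -> H}) :
    (forall k y, ip (delta k y) (delta k y) <= ip y y) ->
    (forall w y, size w = M.+1 -> word_prod (fun k => delta k) w y = 0) ->
  \sum_i ip (partial_sum f (fun k => delta k) M x i)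
            (partial_sum f (fun k => delta k) M x i) <= \sum_j ip (x j) (x j).
Proof.
move=> d_contr d_nilp; set y := partial_sum _ _ _ _.
(* The span of these vectors contains each [x j], through the empty word, and is invariant because
   words of length [M + 1] act as zero. *)
pose s := [seq word_prod (fun k => delta k) p.1 (x p.2) | p : {bseq M of 'I_N} * 'I_q].
have s_mem w j : (size w <= M)%N -> word_prod (fun k => delta k) w (x j) \in s.
  by move=> wM; apply/fintype.imageP; exists (Bseq wM, j).
have [n [e [e_on e_dec e_span]]] := gram_schmidt ip s.
have delta_e : forall k j, delta k (e j) = \sum_i ip (delta k (e j)) (e i) *: e i.
  (* The expansion identity is linear in [y], so it is enough to check it on [s]. *)
  move=> k; apply: (e_span (fun y => delta k y = \sum_i ip (delta k y) (e i) *: e i)).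
  - by rewrite linear0 big1 // => i _; rewrite linear0l scale0r.
  - move=> a u v hu hv; rewrite linearP {1}hu {1}hv scaler_sumr -big_split /=.
    by apply: eq_bigr => i _; rewrite dotDl dotZl scalerDl scalerA.
  move=> _ /fintype.imageP[[w j] _ ->] /=.
  have [Mw|] := ltnP M (size (k :: w)); last by move=> /(s_mem _ j)/e_dec.
  rewrite -[delta k _]/(word_prod (fun k => delta k) (k :: w) (x j)) d_nilp.
    by rewrite big1 // => i _; rewrite linear0l scale0r.
  by apply/eqP; rewrite eqn_leq Mw /= ltnS size_bseq.
pose c j : 'cV_n := \col_i ip (x j) (e i).
have xE j : x j = combination e (c j).
  rewrite {1}(e_dec (x j)); last exact: (s_mem [::]).
  by apply: eq_bigr => i _; rewrite mxE.
have yE i : y i = combination e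
    (\sum_j nilp_eval (coord_mx ip e delta) M (fun w => f w i j) *m c j).
  rewrite ffunE [RHS]linear_sum /=.
  under [RHS]eq_bigr => j _ do rewrite /nilp_eval mulmx_suml linear_sum.
  rewrite [RHS]exchange_big /=; apply: eq_bigr => k _.
  rewrite exchange_big /=; apply: eq_bigr => j _.
  rewrite /hom_eval mulmx_suml linear_sum; apply: eq_bigr => w _.
  by rewrite -scalemxAl linearZ /= xE -combination_word_mx.
under eq_bigr do rewrite yE (dot_combination e_on).
under [leRHS]eq_bigr do rewrite xE (dot_combination e_on).
apply: matrix_inner_nilpotent => [k|w wM].
  exact: lowner_coord_mx.
by apply: (word_mx_coord_eq0 e_on delta_e) => z; exact: d_nilp.
Qed.

End NilpotentContractions.

(** * Direct sums of copies of [K] and the shifted tuple *)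

Section ShiftedTuple.
Variables (C : numClosedFieldType) (K : lmodType C) (ip : {dot K for Num.conj}).

Definition ffun_dot n (x y : {ffun 'I_n -> K}) : C := \sum_i ip (x i) (y i).

Fact ffun_dot_is_bilinear n : bilinear_for
  (GRing.Scale.Law.clone _ _ *%R _) (GRing.Scale.Law.clone _ _ (Num.conj \; *%R) _)
  (@ffun_dot n).
Proof.
split=> [z|z] a x y; rewrite /ffun_dot /= mulr_sumr -big_split; apply: eq_bigr => i _.
  by rewrite !ffunE dotDl dotZl.
by rewrite !ffunE dotDr dotZr.
Qed.

HB.instance Definition _ n := bilinear_isBilinear.Build C _ _ _
  (GRing.Scale.Law.clone _ _ *%R _) (GRing.Scale.Law.clone _ _ (Num.conj \; *%R) _)
  (@ffun_dot n) (@ffun_dot_is_bilinear n).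

Fact ffun_dot_is_hermitian n (x y : {ffun 'I_n -> K}) :
  ffun_dot x y = (-1) ^+ false * (ffun_dot y x)^*.
Proof.
by rewrite expr0 mul1r rmorph_sum; apply: eq_bigr => i _; rewrite dotC.
Qed.

HB.instance Definition _ n := isHermitianSesquilinear.Build C _ _ _
  (@ffun_dot n) (@ffun_dot_is_hermitian n).

Fact ffun_dot_gt0 n (x : {ffun 'I_n -> K}) : x != 0 -> 0 < ffun_dot x x.
Proof.
move=> x0; rewrite lt0r sumr_ge0 ?andbT => [|i _]; last exact: dot_ge0.
apply: contra x0 => /eqP/psumr_eq0P x0; apply/eqP/ffunP => i; rewrite ffunE.
apply/eqP; have /eqP := x0 (fun i _ => dot_ge0 _ _) i isT.
by apply: contraLR => /(neq0_dnorm_gt0 (s := ip)); rewrite lt0r => /andP[].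
Qed.

HB.instance Definition _ n := isDotProduct.Build C _ (@ffun_dot n) (@ffun_dot_gt0 n).

(** The operator [S (x) d]: each component moves up one slot, slot 0 is filled with 0 and the last
    component is lost. The index [l] given to [inord] is always in range. *)
Definition shift M (d : K -> K) (x : {ffun 'I_M.+1 -> K}) : {ffun 'I_M.+1 -> K} :=
  [ffun i : 'I_M.+1 => (if nat_of_ord i is l.+1 then d (x (inord l)) else 0) : K].

Fact shift_is_linear M (d : {linear K -> K}) : linear (@shift M d).
Proof.
move=> a x y; apply/ffunP => i; rewrite !ffunE; case: (nat_of_ord i) => [|l].
  by rewrite scaler0 addr0.
by rewrite !ffunE linearP.
Qed.

HB.instance Definition _ M (d : {linear K -> K}) :=
  GRing.isLinear.Build C _ _ _ (@shift M d) (@shift_is_linear M d).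

Lemma shift_contraction M (d : {linear K -> K}) x :
    (forall y, ip (d y) (d y) <= ip y y) ->
  ffun_dot (@shift M d x) (shift d x) <= ffun_dot x x.
Proof.
move=> hd; rewrite /ffun_dot big_ord_recl [leRHS]big_ord_recr /=.
rewrite !ffunE /= linear0l add0r ler_wpDr ?dot_ge0 //; apply: ler_sum => i _.
rewrite !ffunE /=; apply: le_trans (hd _) _.
have -> // : inord i = widen_ord (leqnSn M) i.
by apply/val_inj; rewrite /= inordK // ltnW ?ltnS.
Qed.

Variables (N : nat) (delta : 'I_N -> {linear K -> K}).

(** A word of length [m] moves components up by [m] slots; in particular words of length [M + 1] act
    as zero. *)
Lemma word_prod_shift M w (x : {ffun 'I_M.+1 -> K}) i :
  word_prod (fun k => shift (delta k)) w x i =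
  if (size w <= i)%N then word_prod (fun k => delta k) w (x (inord (i - size w)))
  else 0.
Proof.
elim: w i => [|k w IH] i /=; first by rewrite subn0 inord_val.
rewrite ffunE /=; case: i => [[|l] /= lM] //.
rewrite IH inordK; last exact: ltnW.
rewrite subSS ltnS; case: ifP => // _.
by rewrite linear0.
Qed.

End ShiftedTuple.

(** * Bounds from the block Toeplitz operator *)

Section ToeplitzBounds.
Variables (R : realType) (N q : nat) (f : fps N 'M[R[i]]_q).
Hypotheses (f_rat : rational_fps f) (f_inner : matrix_inner f).
Variables (K : lmodType R[i]) (ip : {dot K for Num.conj}).

Definition hom_part (delta : 'I_N -> K -> K) k (x : {ffun 'I_q -> K}) i : K :=
  \sum_(w : k.-tuple 'I_N) \sum_(j < q) f (tval w) i j *: word_prod delta (tval w) (x j).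

Lemma partial_sumE delta m x i :
  partial_sum f delta m x i = \sum_(k < m.+1) hom_part delta k x i.
Proof. by rewrite ffunE. Qed.

Variable delta : 'I_N -> {linear K -> K}.
Hypothesis delta_contr : forall k y, ip (delta k y) (delta k y) <= ip y y.

(* The left-hand side is the squared norm of the image of [c (x) x] under the
   lower triangular block Toeplitz operator with blocks [hom_part]. *)
Lemma toeplitz_contraction M (c : nat -> R[i]) (x : {ffun 'I_q -> K}) :
  \sum_i \sum_(l < M.+1)
    (let y := \sum_(k < l.+1) c (l - k)%N *: hom_part (fun k => delta k) k x i in ip y y) <=
  \sum_j \sum_(l < M.+1) ip (c l *: x j) (c l *: x j).
Proof.
pose X : {ffun 'I_q -> {ffun 'I_M.+1 -> K}} :=
  [ffun j => [ffun l : 'I_M.+1 => c (nat_of_ord l) *: x j]].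
have := nilpotent_contraction f_rat f_inner (ip := @ffun_dot _ _ ip M.+1)
  (delta := fun k => @shift _ _ M (delta k)) (M := M) X.
have -> : \sum_j ffun_dot ip (X j) (X j) =
    \sum_j \sum_(l < M.+1) ip (c l *: x j) (c l *: x j).
  by apply: eq_bigr => j _; apply: eq_bigr => l _; rewrite !ffunE.
move=> H; apply: le_trans (H _ _); last 2 first.
- by move=> k y; exact: shift_contraction.
- move=> w y wM; apply/ffunP => l; rewrite word_prod_shift ffunE wM.
  by rewrite leqNgt ltn_ord.
rewrite le_eqVlt; apply/orP; left; apply/eqP; apply: eq_bigr => i _; apply: eq_bigr => l _.
have -> : \sum_(k < l.+1) c (l - k)%N *: hom_part (fun k => delta k) k x i =
  partial_sum f (fun k => @shift _ _ M (delta k)) M X i l; last by [].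
rewrite ffunE.
(* Both sums now run over degrees up to [M]; those above [l] drop out because their words leave slot
   [l] equal to 0. *)
rewrite (big_ord_widen M.+1
  (fun k => c (l - k)%N *: hom_part (fun k => delta k) k x i)) //.
rewrite sum_ffunE [RHS](bigID (fun k : 'I_M.+1 => k < l.+1)%N) /= [X in _ = _ + X]big1 ?addr0.
  apply: eq_bigr => k kl; rewrite scaler_sumr sum_ffunE; apply: eq_bigr => w _.
  rewrite scaler_sumr sum_ffunE; apply: eq_bigr => j _; rewrite !ffunE word_prod_shift.
  rewrite size_tuple -ltnS kl !ffunE inordK; last by rewrite (leq_ltn_trans (leq_subr _ _)).
  have -> : forall w : word N, word_prod (fun k => delta k) w (c (l - k)%N *: x j) =
     c (l - k)%N *: word_prod (fun k => delta k) w (x j).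
    by elim=> [|a u IH] //=; rewrite IH linearZ.
  by rewrite !scalerA mulrC.
move=> k; rewrite -leqNgt => lk; rewrite sum_ffunE big1 // => w _.
rewrite sum_ffunE big1 // => j _.
by rewrite ffunE word_prod_shift size_tuple leqNgt lk /= scaler0.
Qed.

(** With [c] the indicator of 0, the Toeplitz bound concerns the first block column, whose entry in
    row [k] is the homogeneous part of degree [k]. *)
Lemma hom_part_contraction k (x : {ffun 'I_q -> K}) :
  \sum_i ip (hom_part (fun a => delta a) k x i) (hom_part (fun a => delta a) k x i) <=
  \sum_j ip (x j) (x j).
Proof.
have := toeplitz_contraction k (fun l => (l == 0)%:R) x.
have -> : \sum_j \sum_(l < k.+1) ip ((l == 0 :> nat)%:R *: x j) ((l == 0 :> nat)%:R *: x j) =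
    \sum_j ip (x j) (x j).
  apply: eq_bigr => j _; rewrite big_ord_recl /= !scale1r big1 ?addr0 // => l _.
  by rewrite scale0r linear0l.
(* Only block row [k] is kept; the other rows contribute nonnegative terms. *)
apply: le_trans; apply: ler_sum => i _; rewrite big_ord_recr /= ler_wpDl //.
  by apply: sumr_ge0 => l _; exact: dot_ge0.
rewrite big_ord_recr /= subnn eqxx scale1r big1 ?add0r // => l _.
by rewrite subn_eq0 leqNgt ltn_ord scale0r.
Qed.

(** With [c] constantly 1, block row [l] is the partial sum up to degree [l]. *)
Lemma sum_partial_sum_le M (x : {ffun 'I_q -> K}) :
  \sum_(l < M.+1) \sum_i ip (partial_sum f (fun a => delta a) l x i)
                          (partial_sum f (fun a => delta a) l x i) <=
  (\sum_j ip (x j) (x j)) *+ M.+1.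
Proof.
have := toeplitz_contraction M (fun=> 1) x; rewrite exchange_big /=.
have -> : \sum_j \sum_(l < M.+1) ip (1 *: x j) (1 *: x j) =
    (\sum_j ip (x j) (x j)) *+ M.+1.
  rewrite -sumrMnl; apply: eq_bigr => j _; rewrite scale1r.
  by rewrite sumr_const card_ord.
apply: le_trans; apply: ler_sum => l _; apply: ler_sum => i _.
by rewrite partial_sumE; under [in leRHS]eq_bigr do rewrite scale1r.
Qed.

End ToeplitzBounds.


(** * Real-valued norms and operator norm bounds *)

Section RealNorm.
Variables (R : realType) (K : normedModType R[i]).
Implicit Types x y : K.

Lemma rnormE x : `|x| = (rnorm x)%:C.
Proof. by rewrite RRe_real // normr_real. Qed.

Lemma rnorm_ge0 x : 0 <= rnorm x.
Proof. by rewrite -lecR -rnormE; exact: normr_ge0. Qed.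

Lemma rnormD x y : rnorm (x + y) <= rnorm x + rnorm y.
Proof. by rewrite -lecR rmorphD /= -!rnormE ler_normD. Qed.

Lemma rnormN x : rnorm (- x) = rnorm x.
Proof. by rewrite /rnorm normrN. Qed.

Lemma rnorm_sum I (r : seq I) (F : I -> K) :
  rnorm (\sum_(i <- r) F i) <= \sum_(i <- r) rnorm (F i).
Proof.
rewrite -lecR -rnormE rmorph_sum /=; under [leRHS]eq_bigr do rewrite -rnormE.
exact: ler_norm_sum.
Qed.

Lemma rnormZ (a : R) x : 0 <= a -> rnorm (a%:C *: x) = a * rnorm x.
Proof.
move=> a0; apply: complexI; rewrite -rnormE normrZ rmorphM /= -rnormE.
by rewrite ger0_norm // lecR.
Qed.

Lemma rnorm_dist x y : `|rnorm x - rnorm y| <= rnorm (x - y).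
Proof.
rewrite ler_distl; have := rnormD (y - x) x; have := rnormD (x - y) y.
rewrite !subrK -(rnormN (y - x)) opprB => h1 h2.
by apply/andP; split; lra.
Qed.

Lemma rnorm2_ge0 q (x : {ffun 'I_q -> K}) : 0 <= rnorm2 x.
Proof. exact: sqrtr_ge0. Qed.

Lemma rnorm2_sqr q (x : {ffun 'I_q -> K}) : rnorm2 x ^+ 2 = \sum_i rnorm (x i) ^+ 2.
Proof. by rewrite sqr_sqrtr // sumr_ge0 // => i _; rewrite exprn_ge0 ?rnorm_ge0. Qed.

(** The factor [q] is cruder than its square root, but harmless where [b] tends to 0. *)
Lemma rnorm2_le q (x : {ffun 'I_q -> K}) (b : R) :
  0 <= b -> (forall i, rnorm (x i) <= b) -> rnorm2 x <= q%:R * b.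
Proof.
move=> b0 xb; rewrite -(@ler_pXn2r _ 2) ?nnegrE ?mulr_ge0 ?rnorm2_ge0 ?ler0n //.
rewrite rnorm2_sqr; apply: (@le_trans _ _ (\sum_(i < q) b ^+ 2)).
  by apply: ler_sum => i _; rewrite ler_pXn2r ?nnegrE ?rnorm_ge0.
rewrite sumr_const card_ord -[leLHS]mulr_natl exprMn ler_wpM2r ?exprn_ge0 //.
by rewrite -natrX ler_nat; case: (q) => // n; rewrite expnS leq_pmulr ?expn_gt0.
Qed.

Lemma rnorm_cvg (u : nat -> K) l :
  u @ \oo --> l -> (fun n => rnorm (u n)) @ \oo --> rnorm l.
Proof.
move=> /cvgrPdist_lt ul; apply/cvgrPdist_le => e e0.
have /ul : 0 < e%:C by rewrite ltcR.
apply: filterS => n; rewrite rnormE ltcR => /ltW; apply: le_trans.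
exact: rnorm_dist.
Qed.

Lemma opnorm_bound (d : {linear K -> K}) :
    (opnorm (@rnorm _ K) (@rnorm _ K) d < 1)%E ->
  exists r : R, r < 1 /\ forall x, rnorm (d x) <= r * rnorm x.
Proof.
move=> d1; set s := opnorm _ _ _ in d1.
have sup x : rnorm x <= 1 -> ((rnorm (d x))%:E <= s)%E.
  by move=> x1; apply: ereal_sup_ubound; exists x.
have rnorm0 : rnorm (0 : K) = 0 by rewrite /rnorm normr0.
have s0 : (0 <= s)%E by have := sup 0; rewrite linear0 rnorm0; apply; exact: ler01.
have sfin : s \is a fin_num.
  by rewrite ge0_fin_numE // (lt_trans d1) ?ltry.
exists (fine s); split; first by rewrite -lte_fin fineK.
move=> x; have [->|x0] := eqVneq x 0; first by rewrite linear0 rnorm0 mulr0.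
have nx0 : 0 < rnorm x by rewrite -ltcR -rnormE normr_gt0.
(* The supremum only sees the unit ball, so [x] is normalised first. *)
have := sup ((rnorm x)^-1%:C *: x).
rewrite linearZ /= !rnormZ ?invr_ge0 ?rnorm_ge0 // mulVf ?gt_eqF // => /(_ (lexx _)).
by rewrite -{1}(fineK sfin) lee_fin ler_pdivrMl // mulrC.
Qed.

(** Including [2^-1] in the maximum keeps [r] positive even if all operators vanish or [N = 0];
    later arguments divide by [r]. *)
Lemma opnorms_bound N (d : 'I_N -> {linear K -> K}) :
    (forall k, (opnorm (@rnorm _ K) (@rnorm _ K) (d k) < 1)%E) ->
  exists r : R, [/\ 0 < r, r < 1 & forall k x, rnorm (d k x) <= r * rnorm x].
Proof.
move=> d1; have [r rP] := choice (fun k => opnorm_bound (d1 k)).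
exists (\big[Num.max/2^-1]_k r k); split.
- by apply: (@lt_le_trans _ _ 2^-1); rewrite ?invr_gt0 ?ltr0n // bigmax_ge_id.
- apply/bigmax_ltP; split=> [|k _]; last by case: (rP k).
  by rewrite invf_lt1 ?ltr0n // ltr1n.
move=> k x; have [_ /(_ x)/le_trans] := rP k; apply.
by rewrite ler_wpM2r ?rnorm_ge0 // le_bigmax.
Qed.

Section Hilbert.
Variable ip : {dot K for Num.conj}.
Hypothesis ip_norm : forall x, `|x| ^+ 2 = ip x x.

Lemma dot_rnorm x : ip x x = (rnorm x ^+ 2)%:C.
Proof. by rewrite -ip_norm rnormE rmorphXn. Qed.

Lemma dot_sum_rnorm q (x : 'I_q -> K) :
  \sum_i ip (x i) (x i) = (\sum_i rnorm (x i) ^+ 2)%:C.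
Proof. by rewrite rmorph_sum; apply: eq_bigr => i _; rewrite dot_rnorm. Qed.

End Hilbert.
End RealNorm.

Lemma sum_geometric_le (R : realType) (r : R) m n : 0 <= r -> r < 1 ->
  \sum_(m <= k < n) r ^+ k <= r ^+ m / (1 - r).
Proof.
move=> r0 r1; have r1' : 0 < 1 - r by rewrite subr_gt0.
have [mn|/ltnW nm] := leqP m n; last first.
  by rewrite big_geq // divr_ge0 ?exprn_ge0 // ltW.
rewrite ler_pdivlMr // mulr_suml.
have -> : \sum_(m <= k < n) r ^+ k * (1 - r) =
    - \sum_(m <= k < n) (r ^+ k.+1 - r ^+ k).
  by rewrite -sumrN; apply: eq_bigr => k _; rewrite opprB exprSr mulrBr mulr1.
by rewrite telescope_sumr // opprB gerBl exprn_ge0.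
Qed.

(** * Convergence at strict contractions and contractivity of the limit *)

Section SchurAglerProof.
Variables (R : realType) (N q : nat) (f : fps N 'M[R[i]]_q).
Hypotheses (f_rat : rational_fps f) (f_inner : matrix_inner f).
Variables (K : completeNormedModType R[i]) (ip : {dot K for Num.conj}).
Hypothesis ip_norm : hilbert_dot ip.
Variables (delta : 'I_N -> {linear K -> K}) (r : R).
Hypotheses (r_gt0 : 0 < r) (r_lt1 : r < 1).
Hypothesis delta_r : forall k x, rnorm (delta k x) <= r * rnorm x.

Local Notation S := (partial_sum f (fun k => delta k)).

(** The operators [delta a / r] are still contractions, so [hom_part_contraction] applies to them;
    homogeneity of degree [k] then produces the factor [r ^+ k]. *)
Lemma hom_part_le k (x : {ffun 'I_q -> K}) i :
  rnorm (hom_part f (fun a => delta a) k x i) <= r ^+ k * rnorm2 x.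
Proof.
have r_ge0 := ltW r_gt0.
have [d [dE d_contr]] : exists d : 'I_N -> {linear K -> K},
    (forall a y, delta a y = r%:C *: d a y) /\
    (forall a y, ip (d a y) (d a y) <= ip y y).
  exists (fun a => (r^-1)%:C \*: delta a); split=> a y.
    by rewrite /= scalerA -rmorphM /= divff ?gt_eqF // scale1r.
  rewrite !(dot_rnorm ip_norm) lecR ler_pXn2r ?nnegrE ?rnorm_ge0 //.
  by rewrite /= rnormZ ?invr_ge0 // ler_pdivrMl.
have wE w y : word_prod (fun a => delta a) w y =
    (r ^+ size w)%:C *: word_prod (fun a => d a) w y.
  elim: w => [|a w IH]; first by rewrite scale1r.
  by rewrite /= IH linearZ /= dE scalerA -rmorphM /= exprSr.
have -> : hom_part f (fun a => delta a) k x i =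
    (r ^+ k)%:C *: hom_part f (fun a => d a) k x i.
  rewrite scaler_sumr; apply: eq_bigr => w _.
  rewrite scaler_sumr; apply: eq_bigr => j _.
  by rewrite wE size_tuple !scalerA mulrC.
rewrite rnormZ ?exprn_ge0 // ler_wpM2l ?exprn_ge0 //.
rewrite -(@ler_pXn2r _ 2) ?nnegrE ?rnorm_ge0 ?rnorm2_ge0 // rnorm2_sqr.
have := hom_part_contraction f_rat f_inner d_contr k x.
rewrite !(dot_sum_rnorm ip_norm) lecR; apply: le_trans.
by rewrite (bigD1 i) //= lerDl sumr_ge0 // => j _; rewrite exprn_ge0 ?rnorm_ge0.
Qed.

(** The sum of the geometric series from degree [m + 1] on. *)
Definition tail m : R := r ^+ m.+1 / (1 - r).

Lemma tail_ge0 m : 0 <= tail m.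
Proof. by rewrite divr_ge0 ?exprn_ge0 ?subr_ge0 ?(ltW r_gt0) ?(ltW r_lt1). Qed.

Lemma tail_cvg0 (b : R) : (fun m => tail m * b) @ \oo --> (0 : R).
Proof.
have -> : (fun m => tail m * b) = geometric (r / (1 - r) * b) r.
  by apply/funext => m; rewrite /tail /geometric /= exprS; ring.
by apply: cvg_geometric; rewrite ger0_norm // ltW.
Qed.

Lemma partial_sum_cauchy x i m n : (m <= n)%N ->
  rnorm (S n x i - S m x i) <= tail m * rnorm2 x.
Proof.
move=> mn; rewrite !partial_sumE.
rewrite -!(big_mkord xpredT (fun k => hom_part f (fun a => delta a) k x i)).
rewrite (big_cat_nat (n := m.+1)) //=.
rewrite addrAC subrr add0r; apply: le_trans (rnorm_sum _ _) _.
apply: (@le_trans _ _ (\sum_(m.+1 <= k < n.+1) r ^+ k * rnorm2 x)).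
  by apply: ler_sum => k _; exact: hom_part_le.
by rewrite -mulr_suml ler_wpM2r ?rnorm2_ge0 // sum_geometric_le // ltW.
Qed.

Lemma partial_sum_cvg x i : cvg ((fun m => S m x i) @ \oo).
Proof.
apply/cauchy_cvgP/cauchy_exP => e e0.
(* Radii of balls in [K] are elements of [R[i]]; a positive one is real and can be compared in
   [R]. *)
have eE : e = (complex.Re e)%:C by rewrite RRe_real // gtr0_real.
have e0' : 0 < complex.Re e by rewrite -ltcR -eE.
have /cvgrPdist_lt/(_ _ e0')[m _ /(_ m (leqnn m))] := tail_cvg0 (rnorm2 x).
rewrite /= sub0r normrN ger0_norm; last exact: mulr_ge0 (tail_ge0 m) (rnorm2_ge0 x).
move=> hm.
exists (S m x i), m => // n /= mn.
rewrite -ball_normE /= distrC rnormE eE ltcR.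
exact: le_lt_trans (partial_sum_cauchy x i mn) hm.
Qed.

Definition sum_limit (x : {ffun 'I_q -> K}) : {ffun 'I_q -> K} :=
  [ffun i => lim ((fun m => S m x i) @ \oo)].

Lemma sum_limit_cvg x i : (fun m => S m x i) @ \oo --> sum_limit x i.
Proof. by rewrite ffunE; exact: partial_sum_cvg. Qed.

Lemma partial_sum_linear m a x y i : S m (a *: x + y) i = a *: S m x i + S m y i.
Proof.
have wP w u v : word_prod (fun k => delta k) w (a *: u + v) =
    a *: word_prod (fun k => delta k) w u + word_prod (fun k => delta k) w v.
  by elim: w => [//|k w IH] /=; rewrite IH linearP.
rewrite !ffunE scaler_sumr -big_split; apply: eq_bigr => k _ /=.
rewrite scaler_sumr -big_split; apply: eq_bigr => w _ /=.
rewrite scaler_sumr -big_split; apply: eq_bigr => j _ /=.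
by rewrite !ffunE wP scalerDr !scalerA mulrC.
Qed.

Lemma sum_limit_is_linear : linear sum_limit.
Proof.
move=> a x y; apply/ffunP => i; rewrite [LHS]ffunE.
apply/norm_cvg_lim; rewrite !ffunE.
under eq_fun do rewrite partial_sum_linear.
have := @sum_limit_cvg x i; have := @sum_limit_cvg y i; rewrite !ffunE => cy cx.
by apply: cvgD => //; apply: cvgZl_tmp.
Qed.

(** Let [n] tend to infinity in [partial_sum_cauchy]. The bound depends on [x] only through its
    norm, which is what yields convergence in operator norm. *)
Lemma sum_limit_dist x i m : rnorm (sum_limit x i - S m x i) <= tail m * rnorm2 x.
Proof.
apply/ler_addgt0Pr => e e0.
have eC : 0 < e%:C by rewrite ltcR.
have /cvgrPdist_lt/(_ _ eC) H := @sum_limit_cvg x i.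
near \oo => n.
have -> : sum_limit x i - S m x i = (S n x i - S m x i) + (sum_limit x i - S n x i).
  by rewrite [RHS]addrC addrA subrK.
apply: le_trans (rnormD _ _) _; apply: lerD.
  by apply: partial_sum_cauchy; near: n; exact: nbhs_infty_ge.
by apply/ltW; rewrite -ltcR -rnormE; near: n.
Unshelve. all: by end_near.
Qed.

Lemma sum_limit_contraction x : rnorm2 (sum_limit x) <= rnorm2 x.
Proof.
rewrite -(@ler_pXn2r _ 2) ?nnegrE ?rnorm2_ge0 //.
pose u m := rnorm2 (S m x) ^+ 2.
have u_cvg : u @ \oo --> rnorm2 (sum_limit x) ^+ 2.
  rewrite /u rnorm2_sqr; under eq_fun do rewrite rnorm2_sqr.
  apply: cvg_big => [|i _]; first exact: add_continuous.
  by apply: cvgM; apply: rnorm_cvg; exact: sum_limit_cvg.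
(* The available bound controls only averages of the squared norms of the partial sums, but by
   Cesaro these averages have the same limit as the squared norms. *)
have /cvgr_to_le := cesaro u_cvg; apply; apply: nearW => m.
rewrite /arithmetic_mean /= ler_pdivrMl ?ltr0n // /series /= big_mkord.
have d_contr k y : ip (delta k y) (delta k y) <= ip y y.
  rewrite !(dot_rnorm ip_norm) lecR ler_pXn2r ?nnegrE ?rnorm_ge0 //.
  by apply: le_trans (delta_r _ _) _; rewrite ler_piMl ?rnorm_ge0 // ltW.
have := sum_partial_sum_le f_rat f_inner d_contr m x.
under eq_bigr do rewrite (dot_sum_rnorm ip_norm) -rnorm2_sqr.
by rewrite (dot_sum_rnorm ip_norm) -rnorm2_sqr -rmorph_sum -rmorphMn lecR mulr_natl.
Qed.

End SchurAglerProof.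

Theorem corollary6p8 (R : realType) (N q : nat) (f : fps N 'M[R[i]%C]_q) :
  rational_fps f -> matrix_inner f -> schur_agler_nc f.
Proof.
move=> f_rat f_inner K ip ip_norm _ delta /opnorms_bound[r [r0 r1 delta_r]].
pose T : {linear {ffun 'I_q -> K} -> {ffun 'I_q -> K}} :=
  HB.pack (sum_limit f delta) (GRing.isLinear.Build _ _ _ _ (sum_limit f delta)
    (sum_limit_is_linear f_rat f_inner ip_norm r0 r1 delta_r)).
exists T; split; last first.
  apply: ge_ereal_sup => _ [x /= x1 <-]; rewrite lee_fin; apply: le_trans x1.
  exact: (sum_limit_contraction f_rat f_inner ip_norm r0 r1 delta_r).
(* The upper bound is [tail r m] for each component, times the factor [q] from [rnorm2_le]. *)
apply: (@squeeze_cvge _ _ _ _ (cst 0%E) _ (fun m => (tail r m * q%:R)%:E)).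
- apply: nearW => m; apply/andP; split.
    (* The supremum is nonnegative because the unit ball contains 0. *)
    pose g x := T x - partial_sum f (fun k => delta k) m x.
    have : ((rnorm2 (g 0))%:E <= opnorm (@rnorm2 R K q) (@rnorm2 R K q) g)%E.
      apply: ereal_sup_ubound; exists 0 => //=; rewrite /rnorm2 big1 ?sqrtr0 //.
      by move=> i _; rewrite ffunE /rnorm normr0 expr0n.
    by apply: le_trans; rewrite lee_fin rnorm2_ge0.
  apply: ge_ereal_sup => _ [x /= x1 <-]; rewrite lee_fin mulrC.
  apply: rnorm2_le => [|i]; first by rewrite tail_ge0.
  rewrite !ffunE.
  have := sum_limit_dist f_rat f_inner ip_norm r0 r1 delta_r x i m.
  rewrite !ffunE => /le_trans; apply.
  by rewrite ler_piMr // tail_ge0.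
- exact: cvg_cst.
by apply/fine_cvgP; split; [exact: nearW|exact: tail_cvg0].
Qed.
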